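(* Let $K\in\mathcal L(\mathcal H)$, let $\{W_i\}_{i\in I}$ be a family of closed subspaces of $\mathcal H$ and let $\{w_i\}_{i\in I}$ be a family of positive weights. Then the following statements are equivalent: (i) $\mathcal W=\{(W_i,w_i)\}_{i\in I}$ is an atomic system for $K$; (ii) $\mathcal W=\{(W_i,w_i)\}_{i\in I}$ is a $K$-fusion frame for $\mathcal H$, i.e., there exist constants $0<A\le B<\infty$ such that $$A\|K^*f\|^2\le\sum_{i\in I}w_i^2\|\pi_{W_i}(f)\|^2\le B\|f\|^2\quad\text{for all } f\in\mathcal H.$$
   Context: $\mathcal H$ is a separable Hilbert space, $\mathcal L(\mathcal H)$ is the space of bounded linear operators on $\mathcal H$, and $I$ is a countable index set. For a closed subspace $W$, $\pi_W$ denotes the orthogonal projection onto $W$. A family $\mathcal W=\{(W_i,w_i)\}_{i\in I}$ of closed subspaces $W_i$ with weights $w_i>0$ is a Bessel fusion sequence if there is $B<\infty$ with $\sum_{i\in I}w_i^2\|\pi_{W_i}f\|^2\le B\|f\|^2$ for all $f\in\mathcal H$. Put $\big(\sum_{i\in I}\oplus W_i\big)_{\ell^2}=\{\{a_i\}_{i\in I}: a_i\in W_i,\ \sum_{i\in I}\|a_i\|^2<\infty\}$ with inner product $\langle\{a_i\},\{c_i\}\rangle=\sum_{i\in I}\langle a_i,c_i\rangle$. $\mathcal W$ is an atomic system for $K$ if (a) $\mathcal W$ is a Bessel fusion sequence, and (b) there is $C>0$ such that for every $f\in\mathcal H$ there exists $\{a_i\}_{i\in I}\in\big(\sum_{i\in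 I}\oplus W_i\big)_{\ell^2}$ with $\|\{a_i\}\|\le C\|f\|$ and $Kf=\sum_{i\in I}w_ia_i$. *)

(* Defs.v *)
From HB Require Import structures.
From mathcomp Require Import all_boot all_order all_algebra.
From mathcomp Require Import complex.
From mathcomp Require Import all_classical all_reals all_analysis.
From mathcomp.analysis.showcase Require summability.
Set Implicit Arguments.
Unset Strict Implicit.
Unset Printing Implicit Defensive.
Import Order.TTheory GRing.Theory Num.Theory.
Import numFieldNormedType.Exports.
Local Open Scope classical_set_scope.
Local Open Scope ring_scope.

(** Hilbert spaces are taken over the reals or over the complex numbers. *)
Variant scalar_kind := RealScalars | ComplexScalars.

Definition scalars (R : realType) (k : scalar_kind) : numFieldType :=
  match k with
  | RealScalars => R
  | ComplexScalars => R[i]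
  end.

Definition scalar_of_real (R : realType) (k : scalar_kind) : R -> scalars R k :=
  match k with
  | RealScalars => id
  | ComplexScalars => fun x => x%:C%C
  end.

Definition scalar_re (R : realType) (k : scalar_kind) : scalars R k -> R :=
  match k with
  | RealScalars => id
  | ComplexScalars => @complex.Re R
  end.

Definition scalar_conj (R : realType) (k : scalar_kind) :
    scalars R k -> scalars R k :=
  match k with
  | RealScalars => id
  | ComplexScalars => @conjc R
  end.

Arguments scalar_of_real {R} k x.
Arguments scalar_re {R k} x.
Arguments scalar_conj {R k} x.

(** [inner] is linear in its first argument, conjugate-linear in the second. *)
HB.mixin Record CompleteNormedModule_isHilbert (R : realType) (k : scalar_kind)
    H & CompleteNormedModule (scalars R k) H := {
  inner : {dot H for @scalar_conj R k};
  innerxx : forall x : H, inner x x = `|x| ^+ 2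
}.

#[short(type="hilbertType")]
HB.structure Definition Hilbert (R : realType) (k : scalar_kind) :=
  {H of CompleteNormedModule (scalars R k) H
      & CompleteNormedModule_isHilbert R k H}.

Section hilbert_space.
Context {R : realType} {k : scalar_kind} {H : hilbertType R k}.
Implicit Types (x f : H) (V : set H) (K : H -> H).

(** The library norm [`|x|] takes its values in the scalar field; over [R[i]]
    it is a nonnegative element of [R[i]]. [hnorm] is the same norm seen in
    [R]. *)
Definition hnorm x : R := scalar_re `|x|.

Definition separable := exists2 D : set H, countable D & dense D.

Definition bounded_operator K := exists M : R, forall x, hnorm (K x) <= M * hnorm x.

Definition closed_subspace V :=
  [/\ closed V, V 0 & forall (a : scalars R k) x y, V x -> V y -> V (a *: x + y)].

(** The orthogonal projection of [f] onto [V]: the (unique) point of [V] such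
    that [f] minus it is orthogonal to [V]; it exists for closed subspaces. *)
Definition proj V f : H :=
  xget 0 [set g | V g /\ forall h, V h -> inner (f - g) h = 0].

(** The Hilbert adjoint; [adjoint K f] is uniquely determined by the displayed
    condition and exists for bounded linear [K]. *)
Definition adjoint K f : H :=
  xget 0 [set g | forall h, inner (K h) f = inner h g].

End hilbert_space.

Arguments separable {R k} H.

Section fusion.
Context {R : realType} {k : scalar_kind} {H : hilbertType R k} {I : countType}.
Implicit Types (W : I -> set H) (w : I -> R) (K : H -> H) (a : I -> H).

(** Unconditional convergence: the sums over the finite subsets of [I],
    directed by inclusion, converge to [s]. *)
Definition has_sum a (s : H) :=
  summability.partial_sum a @ summability.totally --> s.

Definition fusion_sum W w (f : H) : \bar R :=
  \esum_(i in [set: I]) (w i ^+ 2 * hnorm (proj (W i) f) ^+ 2)%:E.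

Definition bessel_fusion_sequence W w :=
  exists B : R, forall f : H, (fusion_sum W w f <= (B * hnorm f ^+ 2)%:E)%E.

Definition l2_sum W : set (I -> H) :=
  [set a | (forall i, W i (a i)) /\
           (\esum_(i in [set: I]) (hnorm (a i) ^+ 2)%:E < +oo)%E].

(** The norm induced by the inner product [sum_i inner (a i) (c i)] of
    [l2_sum W]. *)
Definition l2_norm a : R :=
  Num.sqrt (fine (\esum_(i in [set: I]) (hnorm (a i) ^+ 2)%:E)).

Definition atomic_system W w K :=
  bessel_fusion_sequence W w /\
  exists2 C : R, 0 < C & forall f : H, exists a : I -> H,
    [/\ l2_sum W a, l2_norm a <= C * hnorm f &
        has_sum (fun i => scalar_of_real k (w i) *: a i) (K f)].

Definition K_fusion_frame W w K :=
  exists A B : R, [/\ 0 < A, A <= B & forall f : H,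
    ((A * hnorm (adjoint K f) ^+ 2)%:E <= fusion_sum W w f)%E /\
    (fusion_sum W w f <= (B * hnorm f ^+ 2)%:E)%E].

End fusion.

(* Main.v *)
Require Import Defs.
From mathcomp Require Import all_boot all_order all_algebra.
From mathcomp Require Import all_classical all_reals all_analysis.
From mathcomp Require Import complex finmap lra ring.
From mathcomp.analysis.showcase Require summability.
Local Open Scope classical_set_scope.
Local Open Scope ring_scope.

(** Let [T] be the synthesis operator [a |-> sum_i w i *: a i] of the family;
    its adjoint is the analysis operator [f |-> (w i *: proj (W i) f)_i], whose
    squared norm at [f] is [fusion_sum W w f]. Being Bessel means that these
    operators are bounded ([synthesis_cvg], [synthesis_norm]), being atomic for
    [K] means that [K] factors through [T] with a norm control, and the lower
    frame bound compares [K^* f] with [T^* f]: the theorem is an instance of the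
    Douglas factorization lemma.

    From atoms to the lower bound ([atoms_lower_bound]): with [g = K^* f] and
    atoms [a] of [K g], the number [|g|^2 = <K g, f>] is the pairing of [a]
    with [T^* f], at most [C |g|] times the norm of [T^* f].

    From the lower bound to atoms ([atoms_exist]): the functional
    [h |-> <K f, h> = <f, K^* h>] is bounded by a multiple of the norm of
    [T^* h], so that it should be represented by a vector of the closed range
    of [T^*]. No Hilbert space structure on the l2-sum is needed for this. The
    lemma [riesz_seq] is a version of the Riesz theorem for a positive
    semidefinite form [q] on a space which need not be complete: a minimising
    sequence of [q x x - 2 * phi x] is Cauchy for [q] and represents [phi] in
    the limit. Applied to [q g h = <S g, h>], where [S = T T^*] is the frame
    operator, it gives vectors [g_n]; the sequences [T^* g_n] converge
    coordinatewise to an l2 sequence [a], and [T a = lim S g_n = K f].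

    The same lemma, applied to the inner product, gives the existence of the
    orthogonal projections ([proj_spec]) and of the adjoint ([adjointP]).

    Both kinds of scalars are treated at once through the real inner product
    [rinner], the real part of [inner]: a scalar identity holds as soon as it
    holds for the real parts of all scalar multiples ([scalar_re_inj]). *)

Set Implicit Arguments.
Unset Strict Implicit.
Unset Printing Implicit Defensive.
Import Order.TTheory GRing.Theory Num.Theory.
Import numFieldNormedType.Exports.

(** * Two facts on real numbers *)

Section real_numbers.
Context {R : realType}.

Lemma ler_double_add (p m a : R) :
  p ^+ 2 <= m * a -> 0 <= m -> 0 <= a -> 2 * p <= m + a.
Proof.
move=> pma m0 a0; have [p0|p0] := lerP p 0; first lra.
rewrite -(@ler_pXn2r _ 2) ?nnegrE; [|by []|lra|lra].
by have := sqr_ge0 (m - a); rewrite !expr2 in pma *; lra.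
Qed.

Lemma le0_harmonic (x D : R) : (forall n, x <= D * n.+1%:R^-1) -> x <= 0.
Proof.
move=> h; have c : (fun n => D * n.+1%:R^-1) @ \oo --> D * 0.
  exact: cvgM (cvg_cst D) (@cvg_harmonic R).
rewrite mulr0 in c.
apply: (ler_cvg_to (cvg_cst x) c).
exact: nearW.
Qed.

End real_numbers.

(** * Scalars *)

Section scalars.
Context {R : realType} {k : scalar_kind}.
Implicit Types (z : scalars R k) (t : R).

Lemma scalar_reD z1 z2 : scalar_re (z1 + z2) = scalar_re z1 + scalar_re z2.
Proof. by case: k z1 z2 => //= -[a b] [c d]. Qed.

Lemma scalar_reM t z : scalar_re (scalar_of_real k t * z) = t * scalar_re z.
Proof. by case: k z => //= -[a b] /=; rewrite mul0r subr0. Qed.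

Lemma scalar_re0 : scalar_re (0 : scalars R k) = 0.
Proof. by case: k. Qed.

Lemma scalar_conj0 : scalar_conj (0 : scalars R k) = 0.
Proof. by case: k => //=; rewrite oppr0. Qed.

Lemma scalar_re_conj z : scalar_re (scalar_conj z) = scalar_re z.
Proof. by case: k z => //= -[a b]. Qed.

Lemma scalar_re_of_real t : scalar_re (scalar_of_real k t) = t.
Proof. by case: k. Qed.

Lemma scalar_of_real1 : scalar_of_real k 1 = 1 :> scalars R k.
Proof. by case: k. Qed.

Lemma scalar_of_realN1 : scalar_of_real k (-1) = -1 :> scalars R k.
Proof. by case: k => //=; rewrite rmorphN. Qed.

Lemma scalar_of_realD t u :
  scalar_of_real k (t + u) = scalar_of_real k t + scalar_of_real k u.
Proof. by case: k => //=; rewrite rmorphD. Qed.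

Lemma scalar_of_realM t u :
  scalar_of_real k (t * u) = scalar_of_real k t * scalar_of_real k u.
Proof. by case: k => //=; rewrite rmorphM. Qed.

Lemma scalar_of_real_lt t u :
  (scalar_of_real k t < scalar_of_real k u) = (t < u).
Proof. by case: k => //=; rewrite ltcR. Qed.

Lemma scalar_of_real_le t u :
  (scalar_of_real k t <= scalar_of_real k u) = (t <= u).
Proof. by case: k => //=; rewrite lecR. Qed.

Lemma ger0_scalarE z : 0 <= z -> z = scalar_of_real k (scalar_re z).
Proof. by case: k z => //= -[a b]; rewrite lecE /= => /andP[/eqP -> _]. Qed.

(** A scalar is determined by the real parts of its multiples: multiplying by
    the imaginary unit exchanges real and imaginary parts. *)
Lemma scalar_re_inj z1 z2 :
  (forall c, scalar_re (c * z1) = scalar_re (c * z2)) -> z1 = z2.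
Proof.
case: k z1 z2 => /= [a b /(_ 1)|[a b] [c d] h]; first by rewrite !mul1r.
have := h 1; rewrite !mul1r /= => ->.
by have /= := h (Complex 0 1); rewrite !mul0r !mul1r !sub0r => /oppr_inj ->.
Qed.

End scalars.

(** * The real inner product *)

Section real_inner_product.
Context {R : realType} {k : scalar_kind} {H : hilbertType R k}.
Implicit Types (x y z : H) (t : R).

(** The real inner product underlying the scalar one. *)
Definition rinner x y : R := scalar_re (inner x y).

(** Multiplication by a real number, whichever the scalar field. *)
Definition rscale t x : H := scalar_of_real k t *: x.

Lemma innerDl x y z : inner (x + y) z = inner x z + inner y z.
Proof. exact: linearDl. Qed.

Lemma innerZl (a : scalars R k) x z : inner (a *: x) z = a * inner x z.
Proof. exact: linearZl_LR. Qed.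

Lemma innerC x y : inner x y = scalar_conj (inner y x).
Proof. by have := hermitian_subproof (s := inner) x y; rewrite expr0 mul1r. Qed.

Lemma rinnerC x y : rinner x y = rinner y x.
Proof. by rewrite /rinner innerC scalar_re_conj. Qed.

Lemma rinnerDl x y z : rinner (x + y) z = rinner x z + rinner y z.
Proof. by rewrite /rinner innerDl scalar_reD. Qed.

Lemma rinnerZl t x z : rinner (rscale t x) z = t * rinner x z.
Proof. by rewrite /rinner innerZl scalar_reM. Qed.

Lemma rscaleN1 x : rscale (-1) x = - x.
Proof. by rewrite /rscale scalar_of_realN1 scaleN1r. Qed.

Lemma rinnerNl x z : rinner (- x) z = - rinner x z.
Proof. by rewrite -rscaleN1 rinnerZl mulN1r. Qed.

Lemma rinnerBl x y z : rinner (x - y) z = rinner x z - rinner y z.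
Proof. by rewrite rinnerDl rinnerNl. Qed.

Lemma rinner0l z : rinner 0 z = 0.
Proof. by rewrite -(subrr 0) rinnerBl subrr. Qed.

Lemma rinnerDr x y z : rinner z (x + y) = rinner z x + rinner z y.
Proof. by rewrite rinnerC rinnerDl !(rinnerC z). Qed.

Lemma rinnerZr t x z : rinner z (rscale t x) = t * rinner z x.
Proof. by rewrite rinnerC rinnerZl (rinnerC z). Qed.

Lemma rinnerBr x y z : rinner z (x - y) = rinner z x - rinner z y.
Proof. by rewrite rinnerC rinnerBl !(rinnerC z). Qed.

Lemma rinner_sum (I : Type) (r : seq I) (u : I -> H) z :
  rinner (\sum_(i <- r) u i) z = \sum_(i <- r) rinner (u i) z.
Proof.
elim: r => [|i r IH]; first by rewrite !big_nil rinner0l.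
by rewrite !big_cons rinnerDl IH.
Qed.

Lemma normr_hnorm x : `|x| = scalar_of_real k (hnorm x).
Proof. exact: ger0_scalarE. Qed.

Lemma rinnerxx x : rinner x x = hnorm x ^+ 2.
Proof.
by rewrite /rinner innerxx normr_hnorm expr2 -scalar_of_realM scalar_re_of_real.
Qed.

Lemma hnorm_ge0 x : 0 <= hnorm x.
Proof.
rewrite /hnorm; have : 0 <= `|x| by [].
by case: k H x => //= E x; rewrite lecE => /andP[].
Qed.

Lemma hnorm0_eq0 x : hnorm x = 0 -> x = 0.
Proof.
move=> h; apply/eqP; rewrite -normr_eq0 normr_hnorm h.
by case: k H x {h}.
Qed.

Lemma hnormrN x : hnorm (- x) = hnorm x.
Proof. by rewrite /hnorm normrN. Qed.

Lemma hnorm_distrC x y : hnorm (x - y) = hnorm (y - x).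
Proof. by rewrite -hnormrN opprB. Qed.

Lemma rinnerxx_ge0 x : 0 <= rinner x x.
Proof. by rewrite rinnerxx sqr_ge0. Qed.

Lemma rinnerxx_eq0 x : rinner x x = 0 -> x = 0.
Proof. by rewrite rinnerxx => /eqP; rewrite sqrf_eq0 => /eqP/hnorm0_eq0. Qed.

(** The weighted arithmetic-geometric form of the Cauchy-Schwarz inequality. *)
Lemma rinner_le2 t x y : 0 < t ->
  2 * rinner x y <= t * rinner x x + t^-1 * rinner y y.
Proof.
move=> t0; have := rinnerxx_ge0 (rscale t x - y).
rewrite !(rinnerBl, rinnerBr, rinnerZl, rinnerZr) (rinnerC y x) => h.
have : 0 <= t^-1 * (t * (t * rinner x x) - t * rinner x y -
  (t * rinner x y - rinner y y)) by rewrite mulr_ge0 // invr_ge0 ltW.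
rewrite (_ : t^-1 * _ = t * rinner x x + t^-1 * rinner y y - 2 * rinner x y).
  by rewrite subr_ge0.
by field; rewrite gt_eqF.
Qed.

Lemma rinner_cauchy_schwarz x y :
  rinner x y ^+ 2 <= rinner x x * rinner y y.
Proof.
have [xx0|/eqP xx0] := eqVneq (rinner x x) 0.
  by rewrite (rinnerxx_eq0 xx0) !rinner0l expr0n mul0r.
have xx : 0 < rinner x x by rewrite lt_neqAle rinnerxx_ge0 eq_sym andbT; apply/eqP.
have := rinnerxx_ge0 (rscale (rinner x x) y - rscale (rinner x y) x).
rewrite !(rinnerBl, rinnerBr, rinnerZl, rinnerZr) (rinnerC y x) => h.
rewrite -(ler_pM2l xx) -subr_ge0; apply: le_trans h _.
by rewrite le_eqVlt; apply/orP; left; apply/eqP; ring.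
Qed.

Lemma cvg_hnorm (T : Type) (F : set_system T) {FF : Filter F} (u : T -> H)
    (s : H) (e : R) :
  u @ F --> s -> 0 < e -> \forall i \near F, hnorm (s - u i) < e.
Proof.
move=> /cvgrPdist_lt h e0.
have e0' : 0 < scalar_of_real k e by case: k => //=; rewrite ltcR.
by apply: filterS (h _ e0') => i; rewrite normr_hnorm scalar_of_real_lt.
Qed.

Lemma ler_hnormD x y : hnorm (x + y) <= hnorm x + hnorm y.
Proof.
rewrite -(scalar_of_real_le (k := k)) scalar_of_realD -!normr_hnorm.
exact: ler_normD.
Qed.

Lemma cvg_hnorm_sqr (T : Type) (F : set_system T) {FF : Filter F} (u : T -> H)
    (s : H) : u @ F --> s -> (fun i => hnorm (u i) ^+ 2) @ F --> hnorm s ^+ 2.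
Proof.
move=> us.
have c : (fun i => hnorm (u i)) @ F --> hnorm s.
  apply/cvgrPdist_lt => e e0; apply: filterS (cvg_hnorm us e0) => i.
  apply: le_lt_trans.
  have := ler_hnormD (s - u i) (u i); have := ler_hnormD (u i - s) s.
  rewrite !subrK (hnorm_distrC (u i)) => h1 h2.
  by rewrite ler_norml; apply/andP; split; lra.
under eq_fun do rewrite expr2; rewrite expr2; exact: cvgM.
Qed.

(** Cauchy filters converge, in terms of the real-valued norm. *)
Lemma hnorm_complete (T : Type) (F : set_system T) {FF : ProperFilter F}
    (u : T -> H) :
  (forall e : R, 0 < e -> exists x, \forall i \near F, hnorm (x - u i) < e) ->
  exists s : H, u @ F --> s.
Proof.
move=> h; suff : cvg (u @ F) by move=> c; exists (lim (u @ F)).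
apply: cauchy_cvg; apply: cauchy_exP => e e0.
have eE := ger0_scalarE (ltW e0).
have e0' : 0 < scalar_re e.
  rewrite -(scalar_of_real_lt (k := k)) -eE.
  by apply: le_lt_trans e0; case: k.
have [x hx] := h _ e0'; exists x.
apply: filterS hx => t ht; rewrite -ball_normE /= eE normr_hnorm.
by rewrite scalar_of_real_lt.
Qed.

Lemma cvg_rinner (T : Type) (F : set_system T) {FF : Filter F} (u : T -> H)
    (s y : H) : u @ F --> s -> (fun i => rinner (u i) y) @ F --> rinner s y.
Proof.
move=> us; apply/cvgrPdist_lt => e e0.
have d0 : 0 < e / (hnorm y + 1) by rewrite divr_gt0 // ltr_wpDl ?hnorm_ge0.
apply: filterS (cvg_hnorm us d0) => t ht.
rewrite -rinnerBl -(@ltr_pXn2r _ 2) ?nnegrE ?(ltW e0) //.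
rewrite -normrX ger0_norm ?sqr_ge0 //.
apply: le_lt_trans (rinner_cauchy_schwarz _ _) _.
rewrite !rinnerxx -exprMn ltr_pXn2r ?nnegrE ?mulr_ge0 ?hnorm_ge0 ?(ltW e0) //.
move: ht; rewrite ltr_pdivlMr ?ltr_wpDl ?hnorm_ge0 //; apply: le_lt_trans.
by rewrite ler_wpM2l ?hnorm_ge0 // lerDl.
Qed.

End real_inner_product.

(** * The Riesz theorem for a positive semidefinite form *)

Section riesz.
Context {R : realType} {k : scalar_kind}.

(** A subspace for the real scalars only: the scalars of [E] may be complex. *)
Definition real_subspace (E : lmodType (scalars R k)) (V : set E) :=
  V 0 /\ forall t x y, V x -> V y -> V (scalar_of_real k t *: x + y).

(** A real functional [phi] on [V] with [phi x ^+ 2 <= M * q x x] is represented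
    by a sequence: [g n] almost minimises [q x x - 2 * phi x] over [V], within
    [n.+1%:R^-1]. Since neither completeness nor definiteness is assumed, the
    sequence need not converge, but it is Cauchy for [q]. *)
Lemma riesz_seq (E : lmodType (scalars R k)) (V : set E) (q : E -> E -> R)
    (phi : E -> R) (M : R) :
  real_subspace V ->
  (forall x y, q x y = q y x) ->
  (forall t x y z, q (scalar_of_real k t *: x + y) z = t * q x z + q y z) ->
  (forall x, 0 <= q x x) ->
  (forall t x y, phi (scalar_of_real k t *: x + y) = t * phi x + phi y) ->
  (forall x, V x -> phi x ^+ 2 <= M * q x x) -> 0 <= M ->
  exists g : nat -> E,
    [/\ forall n, V (g n),
        forall n, q (g n) (g n) <= 4 * M + 2 * n.+1%:R^-1,
        forall n m, q (g n - g m) (g n - g m) <= 2 * (n.+1%:R^-1 + m.+1%:R^-1) &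
        forall n x, V x -> (q (g n) x - phi x) ^+ 2 <= n.+1%:R^-1 * q x x].
Proof.
move=> [V0 VD] qC ql q0 phil phiM M0.
have qr t x y z : q z (scalar_of_real k t *: x + y) = t * q z x + q z y.
  by rewrite qC ql !(qC z).
pose J x := q x x - 2 * phi x.
have phi2 x : V x -> 2 * phi x <= M + q x x.
  by move=> Vx; apply: ler_double_add => //; exact: phiM.
have lbJ : lbound [set J x | x in V] (- M).
  by move=> _ [x Vx <-]; have := phi2 x Vx; rewrite /J; lra.
have infJ : has_inf [set J x | x in V].
  by split; [exists (J 0), 0|exists (- M)].
have Jge x : V x -> inf [set J x | x in V] <= J x.
  by move=> Vx; apply: ge_inf; [exists (- M)|exists x].
have phi0 : phi 0 = 0.
  have := phil 0 0 0; rewrite scaler0 addr0 mul0r add0r.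
  by have := phil 1 0 0; rewrite scaler0 addr0 mul1r; lra.
have qz0 z : q 0 z = 0.
  by have := ql 1 0 0 z; rewrite scaler0 addr0 mul1r; lra.
have qzr z : q z 0 = 0 by rewrite qC.
have J0 : J 0 = 0 by rewrite /J qz0 phi0 mulr0 subr0.
have inf_le0 : inf [set J x | x in V] <= 0 by rewrite -J0; exact: Jge.
have ex n : exists x, V x /\ J x < inf [set J x | x in V] + n.+1%:R^-1.
  have n0 : 0 < n.+1%:R^-1 :> R by rewrite invr_gt0.
  by have [_ [x Vx <-] h] := inf_adherent n0 infJ; exists x.
have [g /all_and2[Vg Jg]] := choice ex.
exists g; split=> // [n|n p|n x Vx].
- have := Jg n; have := phiM _ (Vg n); have := q0 (g n); rewrite /J.
  set a := q _ _; set b := phi _; set e := n.+1%:R^-1 => a0 bM hJ.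
  have : 2 * b <= 2 * M + a / 2 by apply: ler_double_add; lra.
  lra.
- (* The parallelogram identity, applied to the midpoint. *)
  have Vm : V (scalar_of_real k 2^-1 *: g n + (scalar_of_real k 2^-1 *: g p + 0)).
    by do 2 apply: (VD) => //.
  have := Jge _ Vm; have := Jg n; have := Jg p.
  rewrite /J !(ql, qr, phil, qz0, qzr, phi0) (qC (g p) (g n)).
  have -> : g n - g p =
      scalar_of_real k 1 *: g n + (scalar_of_real k (-1) *: g p + 0).
    by rewrite addr0 scalar_of_realN1 scaleN1r scalar_of_real1 scale1r.
  rewrite !(ql, qr, qz0, qzr) (qC (g p) (g n)).
  move: (n.+1%:R^-1) (p.+1%:R^-1) => e e'; lra.
(* Near-minimality along the line through [g n] directed by [x]. *)
have quad t : 0 <= 2 * t * (q (g n) x - phi x) + t ^+ 2 * q x x + n.+1%:R^-1.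
  have := Jge _ (VD t _ _ Vx (Vg n)); have := Jg n.
  rewrite /J !(ql, qr, phil) (qC x (g n)); move: (n.+1%:R^-1) => e; lra.
(* If [q x x = 0] this polynomial in [t] is affine, hence constant; otherwise it
   is evaluated at its minimum. *)
have := q0 x; rewrite le_eqVlt => /orP[/eqP x0|x0].
  have [->|d0] := eqVneq (q (g n) x - phi x) 0.
    by rewrite expr0n mulr_ge0 // invr_ge0.
  have e0 : 0 < n.+1%:R^-1 :> R by rewrite invr_gt0.
  have := quad (- n.+1%:R^-1 / (q (g n) x - phi x)).
  rewrite -x0 mulr0 addr0; move: (n.+1%:R^-1) e0 => e e0.
  have -> : 2 * (- e / (q (g n) x - phi x)) * (q (g n) x - phi x) = - 2 * e.
    by field.
  lra.
have := quad (- (q (g n) x - phi x) / q x x).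
set d := q (g n) x - phi x; set e := n.+1%:R^-1; set a := q x x in x0 *.
have -> : 2 * (- d / a) * d + (- d / a) ^+ 2 * a + e = (e * a - d ^+ 2) / a.
  by field; rewrite gt_eqF.
by rewrite pmulr_lge0 ?invr_gt0 // subr_ge0.
Qed.

End riesz.

(** * Orthogonal projections and adjoints *)

Section projection_and_adjoint.
Context {R : realType} {k : scalar_kind} {H : hilbertType R k}.
Implicit Types (V : set H) (x y f h s : H).
Local Notation proj := Defs.proj.

Lemma harmonic_cauchy_cvg (g : nat -> H) :
  (forall n m, rinner (g n - g m) (g n - g m) <=
    2 * (n.+1%:R^-1 + m.+1%:R^-1)) -> exists s : H, g @ \oo --> s.
Proof.
move=> hg; apply: hnorm_complete => e e0.
have e4 : 0 < e ^+ 2 / 4 by rewrite divr_gt0 ?exprn_gt0.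
have [N _ hN] : \forall n \near \oo, n.+1%:R^-1 < e ^+ 2 / 4.
  have /cvgrPdist_lt/(_ _ e4) := @cvg_harmonic R.
  by apply: filterS => n; rewrite sub0r normrN ger0_norm // invr_ge0.
exists (g N); exists N => // n /= Nn.
rewrite -(@ltr_pXn2r _ 2) ?nnegrE ?hnorm_ge0 ?(ltW e0) // -rinnerxx.
apply: le_lt_trans (hg N n) _; have := hN N (leqnn N); have := hN n Nn.
move=> /=; move: (N.+1%:R^-1) (n.+1%:R^-1) => a b; lra.
Qed.

(** The Riesz theorem on a closed real subspace, for the real inner product. *)
Lemma riesz_representation V (phi : H -> R) (M : R) :
  closed V -> real_subspace V -> 0 <= M ->
  (forall t x y, phi (rscale t x + y) = t * phi x + phi y) ->
  (forall x, V x -> phi x ^+ 2 <= M * rinner x x) ->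
  exists2 g, V g & forall x, V x -> rinner g x = phi x.
Proof.
move=> Vcl Vlin M0 phil phiM.
have ql t x y z : rinner (rscale t x + y) z = t * rinner x z + rinner y z.
  by rewrite rinnerDl rinnerZl.
have [g [Vg _ gC gphi]] := riesz_seq Vlin (@rinnerC _ _ H) ql
  (@rinnerxx_ge0 _ _ H) phil phiM M0.
have [s gs] := harmonic_cauchy_cvg gC.
exists s => [|x Vx]; first by apply: (closed_cvg (u_ := g) V) gs => //; exact: nearW.
have d : (fun n => rinner (g n) x - phi x) @ \oo --> rinner s x - phi x.
  by apply: cvgB; [exact: cvg_rinner|exact: cvg_cst].
have c : (fun n => (rinner (g n) x - phi x) * (rinner (g n) x - phi x)) @ \oo
  --> (rinner s x - phi x) * (rinner s x - phi x) by exact: cvgM.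
have c' : (fun n => rinner x x * n.+1%:R^-1) @ \oo --> rinner x x * 0.
  exact: cvgM (cvg_cst _) (@cvg_harmonic R).
apply/eqP; rewrite -subr_eq0 -sqrf_eq0 eq_le sqr_ge0 andbT -(mulr0 (rinner x x)).
rewrite expr2; apply: (ler_cvg_to c c'); apply: nearW => n /=.
by rewrite -expr2 mulrC; exact: gphi.
Qed.

Lemma closed_subspace_real V : closed_subspace V -> real_subspace V.
Proof. by move=> [_ V0 VD]; split=> // t x y; exact: VD. Qed.

(** Orthogonality for the real inner product to all multiples of [h] is
    orthogonality for the scalar inner product. *)
Lemma inner_eq0 x h :
  (forall c : scalars R k, rinner (c *: h) x = 0) -> inner x h = 0.
Proof.
move=> hc; rewrite innerC; have -> : inner h x = 0.
  by apply: scalar_re_inj => c; rewrite -innerZl mulr0 scalar_re0; exact: hc.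
exact: scalar_conj0.
Qed.

(** On a closed subspace, [proj V f] satisfies its defining condition. *)
Lemma proj_spec V f : closed_subspace V ->
  V (proj V f) /\ forall h, V h -> inner (f - proj V f) h = 0.
Proof.
move=> cV; have [Vcl V0 VD] := cV; rewrite /proj.
case: xgetP => [_ _ //|none]; exfalso.
have [||x Vx|g Vg gphi] := riesz_representation (phi := fun x => rinner x f)
  (M := rinner f f) Vcl (closed_subspace_real cV).
- exact: rinnerxx_ge0.
- by move=> t x y; rewrite rinnerDl rinnerZl.
- by rewrite mulrC; exact: rinner_cauchy_schwarz.
apply: (none g); split=> // h Vh; apply: inner_eq0 => c.
have Vch : V (c *: h) by rewrite -[_ *: _]addr0; exact: VD.
by rewrite rinnerBr (rinnerC _ g) gphi // subrr.
Qed.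

Lemma proj_in V f : closed_subspace V -> V (proj V f).
Proof. by move=> cV; have [] := proj_spec f cV. Qed.

(** [proj V] is the identity seen from [V]: this is how projections enter all
    the sums over the family. *)
Lemma rinner_projr V f h : closed_subspace V -> V h ->
  rinner h (proj V f) = rinner h f.
Proof.
move=> cV Vh; have [_ /(_ h Vh) o] := proj_spec f cV.
apply/eqP; rewrite eq_sym -subr_eq0 -rinnerBr rinnerC /rinner o.
by rewrite scalar_re0.
Qed.

Lemma proj_unique V f g : closed_subspace V -> V g ->
  (forall h, V h -> rinner h g = rinner h f) -> proj V f = g.
Proof.
move=> cV Vg o; apply/eqP; rewrite -subr_eq0; apply/eqP/rinnerxx_eq0.
have Vd : V (proj V f - g).
  have [_ _ VD] := cV; rewrite addrC -scaleN1r; apply: VD => //.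
  exact: proj_in.
by rewrite rinnerBr rinner_projr // o // subrr.
Qed.

Lemma proj_rlinear V t x y : closed_subspace V ->
  proj V (rscale t x + y) = rscale t (proj V x) + proj V y.
Proof.
move=> cV; apply: proj_unique => //.
  by have [_ _ VD] := cV; apply: VD; exact: proj_in.
by move=> h Vh; rewrite !(rinnerDr, rinnerZr) !rinner_projr.
Qed.

Lemma adjointP (K : {linear H -> H}) f h : bounded_operator K ->
  rinner (K h) f = rinner h (adjoint K f).
Proof.
move=> [M KM]; suff e : forall h, inner (K h) f = inner h (adjoint K f).
  by rewrite /rinner e.
rewrite /adjoint; case: xgetP => [_ _ //|none]; exfalso.
have [||||x _|g _ gphi] := riesz_representation (V := setT)
  (phi := fun x => rinner (K x) f) (M := M ^+ 2 * rinner f f).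
- exact: closedT.
- by [].
- by rewrite mulr_ge0 ?sqr_ge0 ?rinnerxx_ge0.
- by move=> t x y; rewrite linearD linearZ rinnerDl rinnerZl.
- apply: le_trans (rinner_cauchy_schwarz _ _) _.
  rewrite mulrAC ler_wpM2r ?rinnerxx_ge0 // !rinnerxx -exprMn.
  rewrite ler_pXn2r ?nnegrE ?hnorm_ge0 //.
  exact: le_trans (hnorm_ge0 _) (KM x).
apply: (none g) => x; apply: scalar_re_inj => c.
rewrite -!innerZl -linearZ -!/(rinner _ _) (rinnerC _ g).
by rewrite gphi.
Qed.

End projection_and_adjoint.

(** * Sums over finite subsets *)

Section finite_sums.
Context {I : choiceType}.
Implicit Types F : {fset I}.
#[local] Existing Instance summability.totally_filter.

Lemma near_totally F0 : \forall F \near summability.totally, (F0 `<=` F)%fset.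
Proof. by exists F0. Qed.

Lemma fsum_split (V : zmodType) (a : I -> V) F0 F : (F0 `<=` F)%fset ->
  \sum_(i <- F) a i = \sum_(i <- F0) a i + \sum_(i <- (F `\` F0)%fset) a i.
Proof.
move=> sF; rewrite -big_cat /=; apply: perm_big; apply: uniq_perm => //.
  rewrite cat_uniq !fset_uniq andbT /=; apply/hasPn => i /=.
  by rewrite !inE => /andP[].
move=> i; rewrite mem_cat in_fsetD /=.
by case: (boolP (i \in F0)) => //= /(fsubsetP sF).
Qed.

Context {R : realType}.
Implicit Types (u : I -> R).

Lemma esum_leP u (c : R) :
  (\esum_(i in [set: I]) (u i)%:E <= c%:E)%E <->
  forall F, \sum_(i <- F) u i <= c.
Proof.
split=> [uc F|uc].
  rewrite -lee_fin; apply: le_trans uc; apply: ereal_sup_ubound.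
  exists [set` F]; first by split.
  by rewrite -fsbig_seq ?fset_uniq // sumEFin.
apply: ge_ereal_sup => _ [A [Afin _] <-].
by rewrite fsbig_finite // sumEFin lee_fin.
Qed.

(** Nonnegative reals with bounded finite sums have small tails. *)
Lemma fsum_tail u (M e : R) : (forall i, 0 <= u i) ->
  (forall F, \sum_(i <- F) u i <= M) -> 0 < e ->
  exists F0, forall F, (F0 `<=` F)%fset -> \sum_(i <- (F `\` F0)%fset) u i < e.
Proof.
move=> u0 uM e0; pose S := [set \sum_(i <- F) u i | F in [set: {fset I}]].
have ubS : has_ubound S by exists M => _ [F _ <-].
have supS : has_sup S by split=> //; exists (\sum_(i <- fset0) u i), fset0.
have [_ [F0 _ <-] h] := sup_adherent e0 supS.
exists F0 => F sF; have : \sum_(i <- F) u i <= sup S.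
  by apply: ub_le_sup => //; exists F.
by rewrite (fsum_split _ sF); move: h; lra.
Qed.

Lemma fsum_subset u F0 F : (forall i, 0 <= u i) -> (F0 `<=` F)%fset ->
  \sum_(i <- F0) u i <= \sum_(i <- F) u i.
Proof. by move=> u0 /fsum_split ->; rewrite lerDl sumr_ge0. Qed.

End finite_sums.

(** * Synthesis and frame operators *)

Section fusion.
Context {R : realType} {k : scalar_kind} {H : hilbertType R k} {I : countType}.
Context (W : I -> set H) (w : I -> R).
Hypothesis Wclosed : forall i, closed_subspace (W i).
Implicit Types (a : I -> H) (f s : H) (F : {fset I}).
Local Notation proj := Defs.proj.
#[local] Existing Instance summability.totally_filter.

Lemma has_sumE a s :
  has_sum a s = ((fun F => \sum_(i <- F) a i) @ summability.totally --> s).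
Proof.
rewrite /has_sum; suff -> : summability.partial_sum a =
  fun F => \sum_(i <- F) a i by [].
by apply/funext => F; rewrite /summability.partial_sum big_seq_fsetE.
Qed.

Lemma has_sum_rinner a s f : has_sum a s ->
  (fun F => \sum_(i <- F) rinner (a i) f) @ summability.totally --> rinner s f.
Proof.
rewrite has_sumE => h.
under eq_fun do rewrite -rinner_sum.
exact: cvg_rinner.
Qed.

Lemma fusion_sum_leP f (c : R) : (fusion_sum W w f <= c%:E)%E <->
  forall F, \sum_(i <- F) w i ^+ 2 * hnorm (proj (W i) f) ^+ 2 <= c.
Proof. exact: esum_leP. Qed.

(** The l2 condition and the bound on the norm, in terms of finite sums. *)
Lemma l2_normP a (M : R) : 0 <= M ->
  (l2_sum W a /\ l2_norm a <= M) <->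
  (forall i, W i (a i)) /\ forall F, \sum_(i <- F) hnorm (a i) ^+ 2 <= M ^+ 2.
Proof.
move=> M0; set S := esum [set: I] (fun i => (hnorm (a i) ^+ 2)%:E).
have S0 : (0 <= S)%E by apply: esum_ge0 => i _; rewrite lee_fin sqr_ge0.
rewrite /l2_sum /= /l2_norm -/S; split.
  move=> [[Wa Sfin] aM]; split=> //; apply/esum_leP; rewrite -/S.
  have Sf : S \is a fin_num by rewrite ge0_fin_numE.
  rewrite -(fineK Sf) lee_fin -[leLHS]sqr_sqrtr ?fine_ge0 //.
  by rewrite ler_pXn2r ?nnegrE ?sqrtr_ge0.
move=> [Wa /esum_leP]; rewrite -/S => SM.
have Sfin : (S < +oo)%E by apply: le_lt_trans SM (ltry _).
have Sf : S \is a fin_num by rewrite ge0_fin_numE.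
split=> //; rewrite -(ger0_norm M0) -sqrtr_sqr ler_sqrt ?sqr_ge0 //.
by rewrite -lee_fin fineK.
Qed.

(** The synthesis operator is formally adjoint to the analysis operator
    [f |-> (w i *: proj (W i) f)]: the pairing of the first with [f] is the
    pairing of [a] with the second, bounded by a weighted arithmetic-geometric
    inequality. The weight [t] is chosen at each use so as to give the effect of
    the Cauchy-Schwarz inequality without square roots. *)
Lemma synthesis_pairing a f F (t : R) : (forall i, W i (a i)) -> 0 < t ->
  2 * (\sum_(i <- F) rinner (rscale (w i) (a i)) f) <=
  t * (\sum_(i <- F) hnorm (a i) ^+ 2) +
  t^-1 * (\sum_(i <- F) w i ^+ 2 * hnorm (proj (W i) f) ^+ 2).
Proof.
move=> Wa t0; rewrite !mulr_sumr -big_split /=; apply: ler_sum => i _.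
have := rinner_le2 (a i) (rscale (w i) (proj (W i) f)) t0.
rewrite !rinnerZr !rinnerZl !rinnerxx (rinner_projr f (Wclosed i) (Wa i)).
by rewrite [w i * (w i * _)]mulrA -expr2.
Qed.

Section bessel.
Context (B : R).
Hypothesis B0 : 0 < B.
Hypothesis bessel : forall f, (fusion_sum W w f <= (B * hnorm f ^+ 2)%:E)%E.

Lemma analysis_le F f :
  B^-1 * (\sum_(i <- F) w i ^+ 2 * hnorm (proj (W i) f) ^+ 2) <= hnorm f ^+ 2.
Proof.
rewrite mulrC ler_pdivrMr // mulrC.
by have /fusion_sum_leP := bessel f.
Qed.

Lemma synthesis_le a F (M : R) : (forall i, W i (a i)) ->
  \sum_(i <- F) hnorm (a i) ^+ 2 <= M ->
  hnorm (\sum_(i <- F) rscale (w i) (a i)) ^+ 2 <= B * M.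
Proof.
move=> Wa aM; set x := \sum_(i <- F) _.
(* The weight [B] turns the second term into at most [hnorm x ^+ 2]. *)
have := synthesis_pairing x F Wa B0.
rewrite -rinner_sum -/x rinnerxx.
have := analysis_le F x.
have : B * (\sum_(i <- F) hnorm (a i) ^+ 2) <= B * M by rewrite ler_pM2l.
lra.
Qed.

Lemma synthesis_cvg a (M : R) : (forall i, W i (a i)) ->
  (forall F, \sum_(i <- F) hnorm (a i) ^+ 2 <= M) ->
  exists s : H, has_sum (fun i => rscale (w i) (a i)) s.
Proof.
move=> Wa aM; suff [s hs] : exists s : H, (fun F =>
    \sum_(i <- F) rscale (w i) (a i)) @ summability.totally --> s.
  by exists s; rewrite has_sumE.
apply: hnorm_complete => e e0.
have d0 : 0 < e ^+ 2 / (2 * B) by rewrite divr_gt0 ?exprn_gt0 ?mulr_gt0.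
have [F0 hF0] := fsum_tail (fun i => sqr_ge0 (hnorm (a i))) aM d0.
exists (\sum_(i <- F0) rscale (w i) (a i)).
apply: filterS (near_totally F0) => F sF.
rewrite hnorm_distrC (fsum_split _ sF) addrC addKr.
rewrite -(@ltr_pXn2r _ 2) ?nnegrE ?hnorm_ge0 ?(ltW e0) //.
apply: le_lt_trans (synthesis_le Wa (ltW (hF0 F sF))) _.
rewrite (_ : B * _ = e ^+ 2 / 2); last by field; rewrite gt_eqF.
by have : 0 < e ^+ 2 by [rewrite exprn_gt0]; lra.
Qed.

Lemma synthesis_norm a s (M : R) : (forall i, W i (a i)) ->
  (forall F, \sum_(i <- F) hnorm (a i) ^+ 2 <= M) ->
  has_sum (fun i => rscale (w i) (a i)) s -> hnorm s ^+ 2 <= B * M.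
Proof.
move=> Wa aM hs; have h := has_sum_rinner (f := s) hs.
rewrite rinnerxx in h.
suff : hnorm s ^+ 2 <= (B * M + hnorm s ^+ 2) / 2 by lra.
apply: (cvgr_to_le h); apply: nearW => F.
have := synthesis_pairing s F Wa B0.
have := analysis_le F s.
have : B * (\sum_(i <- F) hnorm (a i) ^+ 2) <= B * M by rewrite ler_pM2l.
lra.
Qed.

Lemma hnorm_rscale t (x : H) : hnorm (rscale t x) ^+ 2 = t ^+ 2 * hnorm x ^+ 2.
Proof. by rewrite -!rinnerxx rinnerZl rinnerZr mulrA -expr2. Qed.

(** The frame operator [S], obtained by synthesis after analysis. Its form
    [rinner (S g) h] is symmetric, linear and dominates the sums defining
    [fusion_sum W w g]. *)
Lemma frame_operator : exists S : H -> H,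
  [/\ forall g, has_sum (fun i => rscale (w i) (rscale (w i) (proj (W i) g))) (S g),
      forall g h, rinner (S g) h = rinner (S h) g,
      forall t g g' h, rinner (S (rscale t g + g')) h =
        t * rinner (S g) h + rinner (S g') h &
      forall g F, \sum_(i <- F) w i ^+ 2 * hnorm (proj (W i) g) ^+ 2 <=
        rinner (S g) g].
Proof.
have ex g : exists s : H,
    has_sum (fun i => rscale (w i) (rscale (w i) (proj (W i) g))) s.
  apply: (@synthesis_cvg _ (B * hnorm g ^+ 2)) => [i|F].
    have [_ W0 WD] := Wclosed i; rewrite -[rscale _ _]addr0; apply: WD => //.
    exact: proj_in.
  under eq_bigr do rewrite hnorm_rscale.
  by have /fusion_sum_leP := bessel g.
have [S hS] := choice ex.
have Slim g h : (fun F => \sum_(i <- F)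
    w i ^+ 2 * rinner (proj (W i) g) (proj (W i) h)) @ summability.totally -->
    rinner (S g) h.
  have e i : w i ^+ 2 * rinner (proj (W i) g) (proj (W i) h) =
      rinner (rscale (w i) (rscale (w i) (proj (W i) g))) h.
    rewrite (rinner_projr h (Wclosed i)); last exact: proj_in.
    by rewrite !rinnerZl mulrA -expr2.
  under eq_fun do under eq_bigr do rewrite e.
  exact: has_sum_rinner.
have lim_unique (u : {fset I} -> R) (l l' : R) :
    u @ summability.totally --> l -> u @ summability.totally --> l' -> l = l'.
  exact: cvg_unique.
exists S; split=> // [g h|t g g' h|g F].
- apply: lim_unique (Slim g h) _; have := Slim h g.
  by under eq_fun do under eq_bigr do rewrite rinnerC.
- apply: lim_unique (Slim _ h) _.
  under eq_fun do under eq_bigr do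
    rewrite proj_rlinear // rinnerDl rinnerZl mulrDr mulrCA.
  under eq_fun do rewrite big_split -mulr_sumr.
  apply: cvgD; last exact: Slim.
  by apply: cvgM; [exact: cvg_cst|exact: Slim].
- apply: (cvgr_to_ge (Slim g g)); apply: filterS (near_totally F) => F' sF.
  under [leRHS]eq_bigr do rewrite rinnerxx.
  by apply: fsum_subset sF => i; rewrite mulr_ge0 ?sqr_ge0.
Qed.

End bessel.

(** * Atoms and the lower frame bound *)

Section atoms.
Context (K : {linear H -> H}).
Hypothesis Kbounded : bounded_operator K.

(** The atoms of [K g], for [g] the adjoint of [K] at [f], are paired with
    [f]. *)
Lemma atoms_lower_bound (C : R) : 0 < C ->
  (forall f, exists a, [/\ l2_sum W a, l2_norm a <= C * hnorm f &
     has_sum (fun i => rscale (w i) (a i)) (K f)]) ->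
  forall f, (((C ^+ 2)^-1 * hnorm (adjoint K f) ^+ 2)%:E <= fusion_sum W w f)%E.
Proof.
move=> C0 atoms f.
have N0 : (0 <= fusion_sum W w f)%E.
  by apply: esum_ge0 => i _; rewrite lee_fin mulr_ge0 ?sqr_ge0.
have [Nfin|] := ltP (fusion_sum W w f) +oo%E; last first.
  by rewrite leye_eq => /eqP ->; rewrite leey.
have Nf : fusion_sum W w f \is a fin_num by rewrite ge0_fin_numE.
have /fusion_sum_leP : (fusion_sum W w f <= (fine (fusion_sum W w f))%:E)%E.
  by rewrite fineK.
rewrite -{2}(fineK Nf) lee_fin; move: (fine _) => N NF.
set g := adjoint K f; have [a [l2a aC aK]] := atoms g.
have Cg0 : 0 <= C * hnorm g by rewrite mulr_ge0 ?hnorm_ge0 ?ltW.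
have /(l2_normP a Cg0)[Wa aM] : l2_sum W a /\ l2_norm a <= C * hnorm g by [].
have C2 : 0 < C ^+ 2 by rewrite exprn_gt0.
rewrite mulrC ler_pdivrMr //.
have h := has_sum_rinner (f := f) aK.
rewrite adjointP // -/g rinnerxx in h.
suff : hnorm g ^+ 2 <= (hnorm g ^+ 2 + N * C ^+ 2) / 2 by lra.
apply: (cvgr_to_le h); apply: nearW => F.
have Ci : 0 < (C ^+ 2)^-1 by rewrite invr_gt0.
(* With this weight the term in [a] is at most [hnorm g ^+ 2]. *)
have := synthesis_pairing f F Wa Ci.
rewrite invrK.
have : C ^+ 2 * (\sum_(i <- F) w i ^+ 2 * hnorm (proj (W i) f) ^+ 2) <= N * C ^+ 2.
  by rewrite mulrC ler_pM2r.
have : (C ^+ 2)^-1 * (\sum_(i <- F) hnorm (a i) ^+ 2) <= hnorm g ^+ 2.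
  by rewrite mulrC ler_pdivrMr // mulrC -exprMn.
lra.
Qed.

(** The atoms of [K f] are the limit of the analysis sequences of the vectors
    representing [h |-> rinner (K f) h] for the form of the frame operator. *)
Lemma atoms_exist (A B : R) : 0 < A -> 0 < B ->
  (forall f, (fusion_sum W w f <= (B * hnorm f ^+ 2)%:E)%E) ->
  (forall f, ((A * hnorm (adjoint K f) ^+ 2)%:E <= fusion_sum W w f)%E) ->
  forall f, exists a,
    [/\ l2_sum W a, l2_norm a <= 2 * Num.sqrt A^-1 * hnorm f &
     has_sum (fun i => rscale (w i) (a i)) (K f)].
Proof.
move=> A0 B0 bessel lower f.
have [S [hS SC Sl Spart]] := frame_operator B0 bessel.
pose M := A^-1 * hnorm f ^+ 2.
have M0 : 0 <= M by rewrite mulr_ge0 ?sqr_ge0 // invr_ge0 ltW.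
have lower' h : A * hnorm (adjoint K h) ^+ 2 <= rinner (S h) h.
  rewrite -lee_fin; apply: le_trans (lower h) _; exact/fusion_sum_leP.
have KM h : setT h -> rinner (K f) h ^+ 2 <= M * rinner (S h) h.
  move=> _; rewrite adjointP //; apply: le_trans (rinner_cauchy_schwarz _ _) _.
  rewrite !rinnerxx /M (mulrC A^-1) -(mulrA _ A^-1) ler_wpM2l ?sqr_ge0 //.
  by rewrite ler_pdivlMl.
have S0 h : 0 <= rinner (S h) h by have := Spart h fset0; rewrite big_nil.
have phil t x y : rinner (K f) (rscale t x + y) =
    t * rinner (K f) x + rinner (K f) y by rewrite rinnerDr rinnerZr.
have Tlin : real_subspace [set: H] by [].
have [g [_ gM gC gphi]] := riesz_seq Tlin SC Sl S0 phil KM M0.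
(* The analysis sequence of [g n], a Cauchy sequence in the l2-sum. *)
pose b n i := rscale (w i) (proj (W i) (g n)).
have bW n i : W i (b n i).
  have [_ W0 WD] := Wclosed i; rewrite /b -[rscale _ _]addr0; apply: WD => //.
  exact: proj_in.
have bB n m i : b n i - b m i = rscale (w i) (proj (W i) (g n - g m)).
  have -> : g n - g m = rscale (-1) (g m) + g n by rewrite rscaleN1 addrC.
  by rewrite proj_rlinear // rscaleN1 /b /rscale scalerDr scalerN addrC.
have bS n F : \sum_(i <- F) hnorm (b n i) ^+ 2 <= 4 * M + 2 * n.+1%:R^-1.
  under eq_bigr do rewrite hnorm_rscale.
  exact: le_trans (Spart _ _) (gM n).
have bC n m F : \sum_(i <- F) hnorm (b n i - b m i) ^+ 2 <=
    2 * (n.+1%:R^-1 + m.+1%:R^-1).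
  under eq_bigr do rewrite bB hnorm_rscale.
  exact: le_trans (Spart _ _) (gC n m).
have ex i : exists s : H, (b ^~ i) @ \oo --> s.
  apply: harmonic_cauchy_cvg => n m; have := bC n m [fset i]%fset.
  by rewrite big_seq_fset1 rinnerxx.
have [a ab] := choice ex.
have aW i : W i (a i).
  have [Wcl _ _] := Wclosed i.
  by apply: (closed_cvg (u_ := b ^~ i) (W i)) (ab i) => //; exact: nearW.
have sumlim F (u : nat -> I -> H) (s : I -> H) : (forall i, u ^~ i @ \oo --> s i) ->
    (fun n => \sum_(i <- F) hnorm (u n i) ^+ 2) @ \oo -->
    \sum_(i <- F) hnorm (s i) ^+ 2.
  move=> us; apply: (cvg_big (op := +%R)) => [|i _]; first exact: add_continuous.
  exact: cvg_hnorm_sqr.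
have hharm (c d : R) : (fun n => c + d * n.+1%:R^-1) @ \oo --> c.
  rewrite -[X in _ --> X]addr0 -(mulr0 d); apply: cvgD; first exact: cvg_cst.
  by apply: cvgM; [exact: cvg_cst|exact: cvg_harmonic].
have aM F : \sum_(i <- F) hnorm (a i) ^+ 2 <= 4 * M.
  apply: (ler_cvg_to (sumlim F b a ab) (hharm (4 * M) 2)).
  by apply: nearW => n; exact: bS.
have abC n F : \sum_(i <- F) hnorm (b n i - a i) ^+ 2 <= 2 * n.+1%:R^-1.
  have c : forall i, (fun m => b n i - b m i) @ \oo --> b n i - a i.
    by move=> i; apply: cvgB; [exact: cvg_cst|exact: ab].
  apply: (ler_cvg_to (sumlim F _ _ c) (hharm (2 * n.+1%:R^-1) 2)).
  by apply: nearW => m; rewrite -mulrDr; exact: bC.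
have [s hs] := synthesis_cvg B0 bessel aW aM.
have diff n : hnorm (S (g n) - s) ^+ 2 <= B * (2 * n.+1%:R^-1).
  apply: (synthesis_norm B0 bessel (a := fun i => b n i - a i)) => // [i|].
    have [_ _ WD] := Wclosed i; rewrite addrC -scaleN1r; exact: WD.
  have := hS (g n); move: hs; rewrite !has_sumE => hs hSg.
  under eq_fun do rewrite /rscale; under eq_fun do under eq_bigr do rewrite scalerBr.
  by under eq_fun do rewrite sumrB; apply: cvgB.
(* [S (g n)] tends to [s] in norm, and to [K f] weakly. *)
have -> : K f = s.
  apply/esym/eqP; rewrite -subr_eq0; apply/eqP.
  set h := s - K f.
  have hn n : rinner h h ^+ 2 <=
      (2 * rinner (S h) h + 4 * B * rinner h h) * n.+1%:R^-1.
    have h1 := gphi n h Logic.I.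
    have ph := rinner_cauchy_schwarz (S (g n) - s) h.
    have h2 : (rinner (S (g n)) h - rinner s h) ^+ 2 <=
        B * (2 * n.+1%:R^-1) * rinner h h.
      rewrite -rinnerBl; apply: le_trans ph _.
      by rewrite ler_wpM2r ?rinnerxx_ge0 // rinnerxx.
    have hh : rinner h h = rinner s h - rinner (K f) h by rewrite -rinnerBl.
    rewrite [X in X ^+ 2 <= _]hh; move: h1 h2.
    move: (rinner h h) (n.+1%:R^-1) => r e.
    move: (rinner (S (g n)) h) (rinner s h) (rinner (K f) h) => p ps pf.
    have := sqr_ge0 (p - ps + (p - pf)); rewrite !expr2; lra.
  have := le0_harmonic hn.
  rewrite exprn_even_le0 //= => /eqP; exact: rinnerxx_eq0.
exists a.
have C0 : 0 <= 2 * Num.sqrt A^-1 * hnorm f.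
  by rewrite !mulr_ge0 ?sqrtr_ge0 ?hnorm_ge0.
suff /(l2_normP a C0)[] : (forall i, W i (a i)) /\ forall F,
    \sum_(i <- F) hnorm (a i) ^+ 2 <= (2 * Num.sqrt A^-1 * hnorm f) ^+ 2 by split.
split=> // F; rewrite !exprMn sqr_sqrtr ?invr_ge0 ?(ltW A0) //.
have -> : 2 ^+ 2 = 4 :> R by rewrite expr2; lra.
by rewrite -mulrA; exact: aM.
Qed.

End atoms.
End fusion.

Theorem theorem13 (R : realType) (k : scalar_kind) (H : hilbertType R k)
    (K : {linear H -> H}) (I : countType) (W : I -> set H) (w : I -> R)
    (Hsep : separable H) (Kbounded : bounded_operator K)
    (Wclosed : forall i, closed_subspace (W i)) (w_gt0 : forall i, 0 < w i) :
  atomic_system W w K <-> K_fusion_frame W w K.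
Proof.
split.
  move=> [[B bessel] [C C0 atoms]].
  have A0 : 0 < (C ^+ 2)^-1 by rewrite invr_gt0 exprn_gt0.
  exists (C ^+ 2)^-1, (Num.max (C ^+ 2)^-1 B); split=> // [|f].
    by rewrite le_max lexx.
  split; first exact: atoms_lower_bound atoms f.
  apply: le_trans (bessel f) _.
  by rewrite lee_fin ler_wpM2r ?sqr_ge0 // le_max lexx orbT.
move=> [A [B [A0 AB frame]]]; have B0 := lt_le_trans A0 AB.
split; first by exists B => f; have [] := frame f.
exists (2 * Num.sqrt A^-1); first by rewrite mulr_gt0 ?sqrtr_gt0 ?invr_gt0.
apply: (atoms_exist Wclosed Kbounded A0 B0) => f; by have [] := frame f.
Qed.
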